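(* Let $p$ be a prime number such that $p \equiv 1 \pmod 4$, and let $x_p$ and $y_p$ be integers satisfying $p = x_p^2 + y_p^2$ and $0 < x_p < y_p$. Then $$\kappa^+(8p) \equiv 1 - (-1)^{x_p} \pmod 4.$$
   Context: A real quadratic number is a real irrational root $w$ of a quadratic polynomial with integer coefficients; $w'$ denotes its algebraic conjugate over $\mathbb{Q}$. The discriminant $\mathrm{disc}(w)$ of $w$ is $b^2-4ac$, where $aw^2+bw+c=0$ with $a,b,c\in\mathbb{Z}$, $a>0$, $\gcd(a,b,c)=1$. A real quadratic number $w$ is m-reduced if $w>1$ and $0<w'<1$. For a positive non-square integer $D$, $\kappa^+(D)$ denotes the (finite) number of m-reduced real quadratic numbers $w$ with $\mathrm{disc}(w)=D$. *)

(* Defs.v *)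
From HB Require Import structures.
From mathcomp Require Import all_boot all_order all_algebra finmap.
From mathcomp Require Import boolp classical_sets functions cardinality reals.
From mathcomp Require Import zify ring lra.

Set Implicit Arguments.
Unset Strict Implicit.
Unset Printing Implicit Defensive.

Import Order.TTheory GRing.Theory Num.Theory.
Local Open Scope ring_scope.
Local Open Scope classical_set_scope.

Definition real_quadratic (R : realType) (w : R) : Prop :=
  irrational w /\
  exists a b c : int, a != 0 /\ a%:~R * w ^+ 2 + b%:~R * w + c%:~R = 0.

(* v is a root, other than w itself, of every rational polynomial vanishing
   at w; for a real quadratic w there is exactly one such v. *)
Definition is_conjugate (R : realType) (w v : R) : Prop :=
  v != w /\
  forall p : {poly rat},
    root (map_poly ratr p) w -> root (map_poly ratr p) v.

(* For irrational w the primitive triple (a, b, c) is unique, so this is the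
   graph of disc on real quadratic numbers. *)
Definition has_disc (R : realType) (w : R) (D : int) : Prop :=
  exists a b c : int,
    [/\ 0 < a, gcdz (gcdz a b) c = 1,
        a%:~R * w ^+ 2 + b%:~R * w + c%:~R = 0 &
        D = b ^+ 2 - 4 * a * c].

Definition m_reduced (R : realType) (w : R) : Prop :=
  [/\ real_quadratic w, 1 < w &
      exists w' : R, [/\ is_conjugate w w', 0 < w' & w' < 1]].

Definition m_reduced_disc (R : realType) (D : int) : set R :=
  [set w : R | m_reduced w /\ has_disc w D].

(* fset_set A is empty when A is infinite; finite_m_reduced_disc below rules
   that case out. *)
Definition kappa_plus (R : realType) (D : int) : nat :=
  #|` fset_set (@m_reduced_disc R D)|%fset.

Lemma conjugate_root (R : realType) (w v : R) (a b c : int) :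
  is_conjugate w v ->
  a%:~R * w ^+ 2 + b%:~R * w + c%:~R = 0 ->
  a%:~R * v ^+ 2 + b%:~R * v + c%:~R = 0.
Proof.
move=> [_ H] Hw.
pose p : {poly rat} := a%:~R *: 'X^2 + b%:~R *: 'X + (c%:~R)%:P.
have E x : (map_poly ratr p).[x] = a%:~R * x ^+ 2 + b%:~R * x + c%:~R :> R.
  rewrite /p !rmorphD /= !map_polyZ /= map_polyXn map_polyX map_polyC /=.
  by rewrite !ratr_int !hornerE.
have := H p; rewrite /root !E Hw eqxx => /(_ isT) /eqP; exact.
Qed.

Lemma finite_m_reduced_disc (R : realType) (D : int) :
  finite_set (@m_reduced_disc R D).
Proof.
pose n := (`|D|%N).+2.
pose f (u : 'I_n * 'I_n) : R :=
  ((u.2 : nat)%:R + Num.sqrt (D%:~R)) / (2 * (u.1 : nat)%:R).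
apply: (@sub_finite_set _ _ (f @` [set: 'I_n * 'I_n])); last first.
  exact/finite_image/finite_finset.
move=> w [[_ w1 [v [cj v0 v1]]] [a [b [c [a0 _ ew eD]]]]].
have ev := conjugate_root cj ew.
have vw : v != w by case: cj.
have aR : 0 < a%:~R :> R by rewrite ltr0z.
have sumE : b%:~R = - (a%:~R * (w + v)) :> R.
  have : (w - v) * (a%:~R * (w + v) + b%:~R) = 0.
    by rewrite -[RHS](subrr 0) -{1}ew -ev; ring.
  move/eqP; rewrite mulf_eq0 subr_eq0 eq_sym (negbTE vw) /= => /eqP h.
  by apply/eqP; rewrite -subr_eq0 opprK addrC h.
have prodE : c%:~R = a%:~R * (w * v) :> R.
  by apply/eqP; rewrite -subr_eq0 -ew sumE; apply/eqP; ring.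
have b0 : b < 0.
  by rewrite -(ltrz0 R) sumE oppr_lt0 mulr_gt0//; lra.
have c0 : 0 < c by rewrite -(ltr0z R) prodE !mulr_gt0//; lra.
have abc : a + b + c < 0.
  rewrite -(ltrz0 R) !rmorphD /= sumE prodE.
  have -> : a%:~R + - (a%:~R * (w + v)) + a%:~R * (w * v)
          = - (a%:~R * ((w - 1) * (1 - v))) :> R by ring.
  by rewrite oppr_lt0 !mulr_gt0// subr_gt0.
have bac : a + c + 1 <= - b by lia.
have aD : 2 * (a + c) + 1 <= D.
  have h : 0 <= (- b - (a + c + 1)) * (- b + (a + c + 1)) by apply: mulr_ge0; lia.
  rewrite -subr_ge0.
  have -> : D - (2 * (a + c) + 1)
          = (- b - (a + c + 1)) * (- b + (a + c + 1)) + (a - c) ^+ 2.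
    by rewrite eD; ring.
  by rewrite addr_ge0// sqr_ge0.
have acD : (2 * a) * (2 * c) <= D * D by apply: ler_pM; lia.
have bD : - b <= D + 1.
  rewrite -ler_sqr ?nnegrE; [|lia|lia].
  have -> : (- b) ^+ 2 = D + (2 * a) * (2 * c) by rewrite eD; ring.
  have -> : (D + 1) ^+ 2 = D * D + 2 * D + 1 by ring.
  lia.
have an : (`|a| < n)%N by rewrite /n; lia.
have bn : (`|b| < n)%N by rewrite /n; lia.
exists (Ordinal an, Ordinal bn) => //.
have absE (z : int) : (`|z|%N)%:R = (`|z|)%:~R :> R by rewrite -abszE.
rewrite /f /= !absE (gtr0_norm a0) (ltr0_norm b0).
have -> : D%:~R = (a%:~R * (w - v)) ^+ 2 :> R.
  by rewrite eD rmorphB /= rmorphXn !rmorphM /= sumE prodE; ring.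
rewrite sqrtr_sqr gtr0_norm; last by rewrite mulr_gt0//; lra.
by rewrite rmorphN /= sumE; field; rewrite gt_eqF.
Qed.

(* Main.v *)
(* An m-reduced number of discriminant 8p is (b + sqrt (2p)) / a for a unique
   triple with a, c > 0, a + c < 2b and b^2 - ac = 2p. Such triples are
   counted through the set X of solutions of 2h^2 + ab = p with a, b > 0:
   those with a, c odd correspond to X1 = {a > 2b + 4h}, and those with a
   even, as well as those with c even, to the complement of X1, so kappa =
   2 |X| - |X1|, where |X| is even. Exchanging a and c changes the parity of h
   in X1, so |X1| = 2 |B| where B is the part of X1 with h odd. The solutions
   with h odd are 0 modulo 4 in number; removing from them B and its image
   under (h, a, b) -> (-h, b, a) leaves a set on which a Klein four-group
   acts. Its orbits have four elements except those with 2h = a - b, where p =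
   h^2 + (a - h)^2 with |h| < a - h; since h is odd, this happens exactly for
   |h| = x with x odd, in a single orbit of two elements. *)

Require Import Defs.
From mathcomp Require Import all_boot all_order all_algebra reals finmap.
From mathcomp Require Import boolp classical_sets functions cardinality.
From mathcomp Require Import zify ring lra.

Set Implicit Arguments.
Unset Strict Implicit.
Unset Printing Implicit Defensive.

Import Order.TTheory GRing.Theory Num.Theory.
Local Open Scope fset_scope.
Local Open Scope ring_scope.

(** * Counting in finite sets *)

Lemma card_fset_image (K L : choiceType) (f : K -> L) (A : {fset K})
    (B : {fset L}) :
  {in A &, injective f} -> {in A, forall x, f x \in B} ->
  {in B, forall y, exists2 x, x \in A & y = f x} -> #|` A| = #|` B|.
Proof.
move=> f_inj fAB fBA; rewrite -(card_in_imfset imfset_key f_inj) /=.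
congr #|` _|; apply/fsetP => y; apply/imfsetP/idP => [[x xA ->]|/fBA //].
exact: fAB.
Qed.

Lemma in_fset_filter (K : choiceType) (A : {fset K}) (P : pred K) (x : K) :
  (x \in [fset z in A | P z]) = (x \in A) && P x.
Proof. by rewrite !inE. Qed.

Lemma card_fset_split (K : choiceType) (A : {fset K}) (P : pred K) :
  #|` A| = (#|` [fset x in A | P x]| + #|` [fset x in A | ~~ P x]|)%N.
Proof.
rewrite -(cardfsID [fset x in A | P x] A); congr (_ + _)%N; congr #|` _|.
  by apply/fsetP => x; rewrite !inE /= andbA andbb.
by apply/fsetP => x; rewrite !inE /= negb_and andb_orl andNb andbC.
Qed.

(** [f] swaps the elements satisfying [P] with the others, so these two parts are in bijection. *)
Lemma card_fset_flip (K : choiceType) (A : {fset K}) (P : pred K) (f : K -> K) :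
  {in A, forall x, [/\ f x \in A, f (f x) = x & P (f x) = ~~ P x]} ->
  #|` A| = (2 * #|` [fset x in A | P x]|)%N.
Proof.
move=> fA; rewrite (card_fset_split A P) mul2n -addnn; congr (_ + _)%N.
apply/esym/(@card_fset_image _ _ f) => [x y|x|y]; rewrite !inE /=.
- move=> /andP[/fA[_ fx _] _] /andP[/fA[_ fy _] _] eq_f.
  by rewrite -fx eq_f.
- by move=> /andP[/fA[-> _ ->] ->].
- move=> /andP[/fA[yA fy Py] NPy]; exists (f y) => //.
  by rewrite !inE /= yA Py.
Qed.

(** Filtering a finite box of triples turns a bounded solution set into a finite set with an exact
    membership test. *)
Lemma bounded_fset (n : nat) (P : pred (int * int * int)) :
  (forall h a b, P (h, a, b) ->
     [/\ `|h| <= n%:Z, `|a| <= n%:Z & `|b| <= n%:Z]) ->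
  {A : {fset int * int * int} | forall t, (t \in A) = P t}.
Proof.
move=> Pn; pose r := [seq i%:Z - n%:Z | i <- iota 0 (2 * n).+1].
have rP (z : int) : `|z| <= n%:Z -> z \in r.
  move=> zn; apply/mapP; exists (absz (z + n%:Z)); last by lia.
  by rewrite mem_iota; lia.
pose s := [seq (u, b) | u <- [seq (h, a) | h <- r, a <- r], b <- r].
exists [fset t in s | P t] => -[[h a] b].
apply/imfsetP/idP => [[t /andP[_ Pt] -> //]|Pt]; exists (h, a, b) => //.
apply/andP; split=> //; have [/rP hr /rP ar /rP br] := Pn _ _ _ Pt.
by apply: (allpairs_f pair) => //; apply: (allpairs_f pair).
Qed.

(** * The solutions of 2h^2 + ab = p and the reduced forms *)

Lemma reps_subproof (p : nat) :
  {A : {fset int * int * int} | forall t, (t \in A) =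
    let: (h, a, b) := t in [&& 0 < a, 0 < b & 2 * h ^+ 2 + a * b == p%:Z]}.
Proof.
by apply: (@bounded_fset p) => h a b /and3P[a0 b0 /eqP E]; split; nia.
Qed.

Definition reps (p : nat) := sval (reps_subproof p).

Lemma in_reps (p : nat) (h a b : int) :
  (h, a, b) \in reps p =
  [&& 0 < a, 0 < b & 2 * h ^+ 2 + a * b == p%:Z].
Proof. by rewrite (svalP (reps_subproof p)). Qed.

Lemma forms_subproof (p : nat) :
  {A : {fset int * int * int} | forall t, (t \in A) =
    let: (a, b, c) := t in
    [&& 0 < a, 0 < c, a + c < 2 * b & b ^+ 2 - a * c == 2 * p%:Z]}.
Proof.
apply: (@bounded_fset (4 * p)) => a b c /and4P[a0 c0 lt_b /eqP E].
(* As [b ^+ 2 = a * c + 2 * p], this says [(a - c) ^+ 2 + 2 * (a + c) + 1 <= 8 * p], which bounds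
   [a] and [c], then [b]. *)
have h : (a + c + 1) ^+ 2 <= (2 * b) ^+ 2 by rewrite ler_sqr ?nnegrE; lia.
have ac : 2 * (a + c) + 1 <= 8 * p%:Z.
  have : 0 <= (a - c) ^+ 2 by rewrite sqr_ge0.
  by lia.
have b4 : b <= 4 * p%:Z.
  rewrite -ler_sqr ?nnegrE; [|lia|lia].
  have : a * c <= (4 * p%:Z - 1) * (4 * p%:Z - 1) by apply: ler_pM; lia.
  by lia.
by split; lia.
Qed.

(* [(a, b, c)] stands for the form [a X^2 - 2 b X Y + c Y^2]. *)
Definition forms (p : nat) := sval (forms_subproof p).

Lemma in_forms (p : nat) (a b c : int) :
  (a, b, c) \in forms p =
  [&& 0 < a, 0 < c, a + c < 2 * b & b ^+ 2 - a * c == 2 * p%:Z].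
Proof. by rewrite (svalP (forms_subproof p)). Qed.

Lemma int_halves (n : int) : exists k : int, n = 2 * k \/ n = 2 * k + 1.
Proof. by exists (n %/ 2)%Z; lia. Qed.

(** * Counting solutions and forms modulo 4 *)

Section PrimeOneModFour.

Variables (p : nat) (p_prime : prime p) (p_mod4 : p = 1 %[mod 4]).

Lemma reps_odd h a b :
  (h, a, b) \in reps p -> (a %% 2)%Z = 1 /\ (b %% 2)%Z = 1.
Proof. by rewrite in_reps => /and3P[_ _ /eqP E]; nia. Qed.

(** For odd [h], the product [a * b = p - 2 * h ^+ 2] is 3 modulo 4, so one factor is 1 and the
    other 3 modulo 4. *)
Lemma reps_mod4 h a b : (h, a, b) \in reps p -> (h %% 2)%Z = 1 ->
  ((a - b) %% 4)%Z = 2.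
Proof.
move=> hab h1; have [a1 b1] := reps_odd hab.
move: hab; rewrite in_reps => /and3P[_ _ /eqP].
have [i ->] : exists i : int, h = 2 * i + 1 by exists (h %/ 2)%Z; lia.
have [j ->] : exists j : int, a = 2 * j + 1 by exists (a %/ 2)%Z; lia.
have [k ->] : exists k : int, b = 2 * k + 1 by exists (b %/ 2)%Z; lia.
lia.
Qed.

(** [p] divides [(x * v) ^+ 2 - (y * u) ^+ 2], hence [x * v - y * u] or [x * v + y * u]. Writing
    [p ^+ 2] as a sum of two squares shows that factor to be smaller than [p] in absolute value,
    hence 0; only the difference can vanish. *)
Lemma two_squares_unique (x y u v : int) :
  p%:Z = x ^+ 2 + y ^+ 2 -> p%:Z = u ^+ 2 + v ^+ 2 ->
  0 < x -> x < y -> 0 < u -> u < v -> u = x /\ v = y.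
Proof.
move=> Exy Euv x0 xy u0 uv.
have p0 : 0 < p%:Z by nia.
have small (z : int) : (p%:Z %| z)%Z -> z ^+ 2 < p%:Z ^+ 2 -> z = 0.
  case/dvdzP => k ->; rewrite exprMn -[X in _ < X]mul1r ltr_pM2r ?exprn_gt0 //.
  by move=> k1; have -> : k = 0 by apply/eqP; rewrite -sqrf_eq0; lia.
have : (p%:Z %| (x * v - y * u) * (x * v + y * u))%Z.
  apply/dvdzP; exists (x ^+ 2 - u ^+ 2).
  have -> : (x ^+ 2 - u ^+ 2) * p%:Z = x ^+ 2 * p%:Z - u ^+ 2 * p%:Z by ring.
  by rewrite {1}Euv Exy; ring.
have xv0 : 0 < x * v by nia.
have yu0 : 0 < y * u by nia.
have xu0 : 0 < x * u by nia.
have xuyv : x * u < y * v by nia.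
rewrite dvdzE abszM Euclid_dvdM // => /orP[|] /small h.
  have {}h : x * v - y * u = 0.
    apply: h; have -> : p%:Z ^+ 2 = (x * v - y * u) ^+ 2 + (x * u + y * v) ^+ 2.
      by rewrite expr2 {1}Exy Euv; ring.
    by rewrite ltrDl exprn_gt0 //; lia.
  have xu : x ^+ 2 = u ^+ 2.
    apply: (mulIf (lt0r_neq0 p0)); rewrite {1}Euv Exy.
    have -> : x ^+ 2 * (u ^+ 2 + v ^+ 2) = (x * u) ^+ 2 + (x * v) ^+ 2 by ring.
    by rewrite (subr0_eq h); ring.
  have eq_sqr (z t : int) : 0 < z -> 0 < t -> z ^+ 2 = t ^+ 2 -> z = t.
    by move=> z0 t0 zt; apply/eqP; rewrite -(@eqrXn2 _ 2) ?ltW //; apply/eqP.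
  have -> : u = x by apply: eq_sqr.
  split=> //; apply: eq_sqr; lia.
have : x * v + y * u = 0.
  apply: h; have -> : p%:Z ^+ 2 = (x * v + y * u) ^+ 2 + (y * v - x * u) ^+ 2.
    by rewrite expr2 {1}Exy Euv; ring.
  by rewrite ltrDl exprn_gt0 //; lia.
lia.
Qed.

(** Negating [h] fixes nothing when [h != 0]; for [h = 0], exchanging [a] and [b] fixes nothing
    because a prime is not a square. *)
Lemma card_reps_even : (2 %| #|` reps p|)%N.
Proof.
rewrite (card_fset_split _ (fun t => t.1.1 == 0)) dvdn_add //.
  pose f (t : int * int * int) := (t.1.1, t.2, t.1.2).
  rewrite (@card_fset_flip _ _ (fun t => t.1.2 < t.2) f) ?dvdn_mulr //.
  move=> [[h a] b]; rewrite /f !in_fset_filter /= !in_reps.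
  move=> /andP[/and3P[a0 b0 /eqP E]].
  move=> /eqP h0; split => //.
    by rewrite b0 a0 h0 /= andbT -E h0; apply/eqP; ring.
  have ab : a != b.
    apply/eqP => ab; have aa : (absz a * absz a)%N = p by nia.
    have [p1] := primeP p_prime.
    move=> /(_ (absz a)); rewrite -{1}aa dvdn_mulr // => /(_ isT).
    by case/orP => /eqP; nia.
  by lia.
pose f (t : int * int * int) := (- t.1.1, t.1.2, t.2).
rewrite (@card_fset_flip _ _ (fun t => t.1.1 < 0) f) ?dvdn_mulr //.
move=> [[h a] b]; rewrite /f !in_fset_filter /= !in_reps sqrrN oppr_eq0.
by move=> /andP[-> h0]; rewrite h0 opprK; split => //; lia.
Qed.

(** This is X1, and [forms_small] is its complement in X: equality would make [a] even. *)
Definition forms_big := [fset t in reps p | 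
  let: (h, a, b) := t in 2 * b + 4 * h < a].
Definition forms_small := [fset t in reps p | 
  let: (h, a, b) := t in a < 2 * b + 4 * h].

Lemma card_forms_split : #|` reps p| = (#|` forms_big| + #|` forms_small|)%N.
Proof.
rewrite (card_fset_split _ (fun t => 2 * t.2 + 4 * t.1.1 < t.1.2)).
congr (_ + _)%N; congr #|` _|; apply/fsetP => -[[h a] b];
  rewrite !in_fset_filter //=.
by apply: andb_id2l => /reps_odd[]; lia.
Qed.

Definition corner := [fset t in forms_big | (t.1.1 %% 2)%Z == 1].

Lemma modz2N (h : int) : ((- h) %% 2 == 1)%Z = (h %% 2 == 1)%Z.
Proof. lia. Qed.

(* [f] exchanges the outer coefficients of the form
   [(a, a - 2 * h, a - 4 * h - 2 * b)] attached to [(h, a, b)]. *)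
Lemma card_forms_big : #|` forms_big| = (2 * #|` corner|)%N.
Proof.
pose f (t : int * int * int) :=
  let: (h, a, b) := t in (- b - h, a - 4 * h - 2 * b, b).
have par (i j : int) : (j %% 2)%Z = 1 ->
    (((- j - i) %% 2)%Z == 1) = ((i %% 2)%Z != 1) by lia.
apply: (@card_fset_flip _ _ _ f) => -[[h a] b].
rewrite !in_fset_filter /= => /andP[hab lt_a]; have [a1 b1] := reps_odd hab.
move: hab; rewrite !in_reps => /and3P[a0 b0 /eqP E]; split.
- rewrite b0; apply/andP; split; last by lia.
  by apply/and3P; split=> //; [lia | apply/eqP; rewrite -E; ring].
- by congr (_, _, _); lia.
- exact: par.
Qed.

Definition odd_reps := [fset t in reps p | (t.1.1 %% 2)%Z == 1].

(** Negating [h] halves the count since an odd [h] is nonzero; exchanging [a] and [b] halves it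
    again since [reps_mod4] gives [a != b]. *)
Lemma card_odd_reps : (4 %| #|` odd_reps|)%N.
Proof.
pose f (t : int * int * int) := (- t.1.1, t.1.2, t.2).
rewrite (@card_fset_flip _ _ (fun t => t.1.1 < 0) f); last first.
  move=> [[h a] b]; rewrite /f !in_fset_filter /= !in_reps sqrrN.
  move=> /andP[-> h1].
  by rewrite opprK; split => //; lia.
pose g (t : int * int * int) := (t.1.1, t.2, t.1.2).
rewrite (@card_fset_flip _ _ (fun t => t.1.2 < t.2) g); last first.
  move=> [[h a] b]; rewrite /g !in_fset_filter /= => /andP[/andP[hab h1] h0].
  have ab := reps_mod4 hab (eqP h1).
  move: hab; rewrite !in_reps => /and3P[a0 b0 E].
  by rewrite a0 b0 (mulrC b) E h1 h0; split => //; lia.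
by rewrite mulnA dvdn_mulr.
Qed.

Definition middle := [fset t in odd_reps |
  let: (h, a, b) := t in (a < 2 * b + 4 * h) && (b < 2 * a - 4 * h)].

(** [corner] and its image under [(h, a, b) -> (-h, b, a)] are disjoint: adding [2 * b + 4 * h < a]
    and [2 * a - 4 * h < b] would give [a + b < 0]. *)
Lemma card_corner_middle :
  #|` odd_reps| = (2 * #|` corner| + #|` middle|)%N.
Proof.
rewrite (card_fset_split _ (fun t => 2 * t.2 + 4 * t.1.1 < t.1.2)).
have -> : [fset t in odd_reps | 2 * t.2 + 4 * t.1.1 < t.1.2] = corner.
  by apply/fsetP => -[[h a] b]; rewrite !in_fset_filter /= andbAC.
rewrite mul2n -addnn -addnA; congr (_ + _)%N.
rewrite (card_fset_split _ (fun t => 2 * t.1.2 - 4 * t.1.1 < t.2)).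
congr (_ + _)%N; last first.
  congr #|` _|; apply/fsetP => -[[h a] b]; rewrite !in_fset_filter /= -!andbA.
  by apply: andb_id2l => /reps_odd[]; lia.
apply/esym/(@card_fset_image _ _ (fun t => (- t.1.1, t.2, t.1.2))).
- by move=> [[h a] b] [[h' a'] b'] _ _ /= [] /oppr_inj -> -> ->.
- move=> [[h a] b]; rewrite !in_fset_filter /= !in_reps sqrrN (mulrC b).
  move=> /andP[/andP[/and3P[a0 b0 ->] lt1] h1].
  by rewrite a0 b0 /= modz2N h1 /=; lia.
- move=> [[h a] b]; rewrite !in_fset_filter /=.
  move=> /andP[/andP[/andP[hab h1] lt1] lt2].
  exists (- h, b, a); last by rewrite /= opprK.
  move: hab; rewrite !in_fset_filter /= !in_reps sqrrN (mulrC b).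
  by move=> /and3P[-> -> ->] /=; rewrite modz2N h1 /=; lia.
Qed.

(* In the coordinates u = (a - b) / 2 - 2h, v = (a + b) / 2 and
   t = (a - b - 2h) / 4, [reps p] is given by u^2 + v^2 - 8t^2 = p and [middle]
   by |u| + 4|t| < v; the involutions [f] and [g] are (u, t) -> (-u, -t) and
   t -> -t. *)
Lemma card_middle (x y : int) : p%:Z = x ^+ 2 + y ^+ 2 -> 0 < x -> x < y ->
  exists k, #|` middle| = (2 * ((x %% 2)%Z == 1%Z) + 4 * k)%N.
Proof.
move=> Exy x0 xy.
pose f (t : int * int * int) := (- t.1.1, t.2, t.1.2).
(* The test is [u > 0]; by [reps_mod4], [u] is odd, hence nonzero. *)
rewrite (@card_fset_flip _ _ (fun t => t.2 + 4 * t.1.1 < t.1.2) f); last first.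
  move=> [[h a] b]; rewrite /f !in_fset_filter /=.
  move=> /andP[/andP[hab /eqP h1] /andP[lt1 lt2]].
  have ab := reps_mod4 hab h1.
  move: hab; rewrite !in_reps sqrrN opprK (mulrC b) => /and3P[-> -> ->] /=.
  by rewrite modz2N h1 /=; split => //; lia.
pose g (t : int * int * int) :=
  let: (h, a, b) := t in (3 * h + b - a, 2 * b + 4 * h - a, 2 * a - 4 * h - b).
rewrite (card_fset_split _ (fun t => 2 * t.1.1 == t.1.2 - t.2)).
set M := [fset t in middle | _].
have -> : #|` [fset t in M | 2 * t.1.1 == t.1.2 - t.2]| =
    ((x %% 2)%Z == 1) :> nat.
  (* With coordinate [t = 0] one has [u = - h], so [u > 0] selects [h < 0], and uniqueness of the
     two squares leaves one triple. It has [h] odd only if [x] is odd. *)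
  have tP h a b : (h, a, b) \in M -> 2 * h = a - b ->
      [/\ h = - x, a = y - x & b = y + x].
    rewrite /M !in_fset_filter /=.
    move=> /andP[/andP[/andP[hab /eqP h1] /andP[lt1 lt2]] u0] t0.
    have ab := reps_mod4 hab h1.
    move: hab; rewrite !in_reps => /and3P[a0 b0 /eqP E].
    have eb : b = a - 2 * h by lia.
    have Eh : p%:Z = (- h) ^+ 2 + (a - h) ^+ 2 by rewrite -E eb; ring.
    have [] := two_squares_unique Exy Eh x0 xy; [lia | lia |].
    by split; lia.
  case: eqP => [x1|x1].
    rewrite (_ : [fset t in M | _] = [fset (- x, y - x, y + x)]) ?cardfs1 //.
    apply/fsetP => -[[h a] b]; rewrite in_fset1 in_fset_filter /=.
    apply/andP/eqP => [[+ /eqP] | [-> -> ->]].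
      by move=> /tP + /[dup] => /[apply] [[-> -> ->]].
    split; last by lia.
    rewrite /M !in_fset_filter /= in_reps modz2N x1 /= Exy.
    have -> : 2 * (- x) ^+ 2 + (y - x) * (y + x) = x ^+ 2 + y ^+ 2 by ring.
    by rewrite eqxx; lia.
  apply/eqP; rewrite cardfs_eq0; apply/eqP/fsetP => -[[h a] b].
  rewrite in_fset_filter in_fset0.
  apply/negP => /andP[hM /eqP /(tP _ _ _ hM)[hx _ _]].
  move: hM; rewrite /M !in_fset_filter /= hx modz2N.
  by move=> /andP[/andP[/andP[_ /eqP]]].
rewrite (@card_fset_flip _ _ (fun t => 2 * t.1.1 < t.1.2 - t.2) g); last first.
  move=> [[h a] b]; rewrite /g /M !in_fset_filter /=.
  move=> /andP[/andP[/andP[/andP[hab /eqP h1] /andP[lt1 lt2]] u0] t0].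
  have ab := reps_mod4 hab h1.
  move: hab; rewrite !in_reps => /and3P[a0 b0 /eqP E].
  split.
  - apply/andP; split; last by lia.
    apply/andP; split; last by lia.
    apply/andP; split; last by lia.
    apply/andP; split; last by lia.
    apply/and3P; split; [lia | lia | apply/eqP; rewrite -E; ring].
  - by congr (_, _, _); lia.
  - by lia.
by eexists; rewrite mulnDr mulnA.
Qed.
(** Both [f1] and [f2] yield the invariant [4 * h ^+ 2 + 2 * a * b = 2 * p]. Outer coefficients are
    never both even, or a square would be 2 modulo 4; so [g] exchanges the forms with [a] even and
    those with [c] even. *)
Lemma card_forms : #|` forms p| = (#|` forms_big| + 2 * #|` forms_small|)%N.
Proof.
pose f1 (t : int * int * int) :=
  let: (h, a, b) := t in (a, a - 2 * h, a - 4 * h - 2 * b).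
pose f2 (t : int * int * int) :=
  let: (h, a, b) := t in (2 * b, 2 * b + 2 * h, 2 * b + 4 * h - a).
rewrite (card_fset_split _ (fun t => (t.1.1 %% 2 == 1)%Z && (t.2 %% 2 == 1)%Z)).
congr (_ + _)%N.
  apply/esym/(@card_fset_image _ _ f1).
  - move=> [[h a] b] [[h' a'] b'] _ _ [-> e1 e2].
    by congr (_, _, _); lia.
  - move=> [[h a] b]; rewrite !in_fset_filter /= in_forms => /andP[hab lt1].
    have [a1 b1] := reps_odd hab.
    move: hab; rewrite in_reps => /and3P[a0 b0 /eqP E].
    apply/andP; split; last by lia.
    by apply/and4P; split; [lia | lia | lia | apply/eqP; rewrite -E; ring].
  - move=> [[a B] c]; rewrite !in_fset_filter /= in_forms.
    move=> /andP[/and4P[a0 c0 lt1 /eqP E] /andP[/eqP a1 /eqP c1]].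
    have [j ea] : exists j : int, a = 2 * j + 1 by exists (a %/ 2)%Z; lia.
    have [k ec] : exists k : int, c = 2 * k + 1 by exists (c %/ 2)%Z; lia.
    have [i [eB|eB]] := int_halves B; first by move: E; rewrite ea eB ec; lia.
    (* Inverting [f1] gives [h = (a - B) / 2] and [b = (2 * B - a - c) / 2], positive because
       [a + c < 2 * B]. *)
    exists (j - i, 2 * j + 1, 2 * i - j - k).
      rewrite in_fset_filter in_reps.
      apply/andP; split; last by lia.
      by apply/and3P; split; [lia | lia | apply/eqP; lia].
    by rewrite /f1; congr (_, _, _); lia.
pose g (t : int * int * int) := (t.2, t.1.2, t.1.1).
rewrite (@card_fset_flip _ _ (fun t => t.1.1 %% 2 == 0)%Z g); last first.
  move=> [[a B] c]; rewrite /g !in_fset_filter /= !in_forms.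
  move=> /andP[/and4P[a0 c0 lt1 /eqP E] ac].
  have ac0 : ~~ ((a %% 2 == 0)%Z && (c %% 2 == 0)%Z).
    apply/negP => /andP[/eqP a2 /eqP c2].
    have [j ea] : exists j : int, a = 2 * j by exists (a %/ 2)%Z; lia.
    have [k ec] : exists k : int, c = 2 * k by exists (c %/ 2)%Z; lia.
    by have [i [eB|eB]] := int_halves B; move: E; rewrite ea ec eB; lia.
  split=> //; last by lia.
  apply/andP; split; last by lia.
  by apply/and4P; split; [lia | lia | lia | apply/eqP; rewrite -E; ring].
congr (2 * _)%N; apply/esym/(@card_fset_image _ _ f2).
- move=> [[h a] b] [[h' a'] b'] _ _ [e1 e2 e3].
  by congr (_, _, _); lia.
- move=> [[h a] b]; rewrite !in_fset_filter /= in_forms => /andP[hab lt1].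
  have [a1 b1] := reps_odd hab.
  move: hab; rewrite in_reps => /and3P[a0 b0 /eqP E].
  apply/andP; split; last by lia.
  apply/andP; split; last by lia.
  by apply/and4P; split; [lia | lia | lia | apply/eqP; rewrite -E; ring].
- move=> [[a B] c]; rewrite !in_fset_filter /= in_forms.
  move=> /andP[/andP[/and4P[a0 c0 lt1 /eqP E] _] /eqP a2].
  have [j ea] : exists j : int, a = 2 * j by exists (a %/ 2)%Z; lia.
  have [i [eB|eB]] := int_halves B; last by move: E; rewrite ea eB; lia.
  (* Inverting [f2]: here positivity of the second entry is [a + c < 2 * B]. *)
  exists (i - j, 2 * B - a - c, j).
    rewrite in_fset_filter in_reps.
    apply/andP; split; last by lia.
    by apply/and3P; split; [lia | lia | apply/eqP; lia].
  by rewrite /f2; congr (_, _, _); lia.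
Qed.

(** The count is 2|X| - 2|B|, where 2|X| is 0 modulo 4 and 2|B| is the size of [odd_reps] minus that
    of [middle]; so it is congruent to the size of [middle]. *)
Lemma card_forms_mod4 (x y : int) : p%:Z = x ^+ 2 + y ^+ 2 -> 0 < x -> x < y ->
  (#|` forms p| = 2 * ((x %% 2)%Z == 1%Z) %[mod 4])%N.
Proof.
move=> Exy x0 xy; have [k m4] := card_middle Exy x0 xy.
have /dvdnP[i r2] := card_reps_even; have /dvdnP[j o4] := card_odd_reps.
have := card_forms; have := card_forms_split; have := card_forms_big.
have := card_corner_middle; lia.
Qed.

End PrimeOneModFour.

(** * Irrationality and conjugates *)

Section Kappa.

Variables (R : realType) (p : nat).
Hypotheses (p_prime : prime p) (p_mod4 : p = 1 %[mod 4]).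

(** After clearing denominators, the exponent of 2 is even on one side and odd on the other, as [p]
    is odd. *)
Lemma ratr_sqr_neq_double_prime (q : rat) : ratr q ^+ 2 != (2 * p%:Z)%:~R :> R.
Proof.
apply/eqP => E.
have {}E : q ^+ 2 = (2 * p%:Z)%:~R.
  by apply: (fmorph_inj (ratr : rat -> R)); rewrite rmorphXn /= E ratr_int.
have d0 : (denq q)%:~R != 0 :> rat by rewrite intr_eq0 denq_neq0.
have {}E : numq q ^+ 2 = (2 * p%:Z) * denq q ^+ 2.
  apply: (intr_inj (R := rat)); rewrite (intrM _ (2 * p%:Z)) -E !rmorphXn /=.
  rewrite -exprMn.
  by rewrite -{2}[q]divq_num_den divfK.
have p0 := prime_gt0 p_prime.
have dn0 : (0 < absz (denq q))%N by rewrite absz_gt0 denq_neq0.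
have {}E : (absz (numq q) ^ 2 = 2 * p * absz (denq q) ^ 2)%N by lia.
have := congr1 (logn 2) E.
rewrite lognX (@lognM 2 (2 * p)) ?expn_gt0 ?muln_gt0 ?p0 ?dn0 //.
rewrite lognX (@lognM 2 2 p) //.
have -> : logn 2 p = 0%N.
  apply/eqP; rewrite -[_ == _]negbK -lt0n logn_gt0 mem_primes p0 /= dvdn2.
  by lia.
rewrite (_ : logn 2 2 = 1%N) //; lia.
Qed.

Lemma irrational_affine (w : R) (e f : rat) :
  irrational w -> ratr e * w + ratr f = 0 -> e = 0 /\ f = 0.
Proof.
move=> w_irr E; have e0 : e = 0.
  apply/eqP/negPn/negP => e0; apply: w_irr; exists (- f / e) => //.
  have re0 : ratr e != 0 :> R by rewrite fmorph_eq0.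
  rewrite fmorph_div rmorphN /=; apply: (mulfI re0).
  by rewrite mulrCA divff // mulr1; apply/eqP; rewrite eq_sym -subr_eq0 opprK E.
split=> //; apply/eqP; rewrite -(fmorph_eq0 (ratr : rat -> R)).
by rewrite -E e0 rmorph0 mul0r add0r.
Qed.

(** Dividing by the quadratic leaves a rational remainder of degree at most one; it vanishes at the
    irrational [w], hence is zero. *)
Lemma quadratic_conjugate (w v : R) (a b c : int) : irrational w -> v != w ->
  a != 0 ->
  a%:~R * w ^+ 2 + b%:~R * w + c%:~R = 0 ->
  a%:~R * v ^+ 2 + b%:~R * v + c%:~R = 0 -> is_conjugate w v.
Proof.
move=> w_irr vw a0 Ew Ev; split=> // P.
pose d : {poly rat} := a%:~R *: 'X^2 + b%:~R *: 'X + (c%:~R)%:P.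
have hd x : (map_poly ratr d).[x] = a%:~R * x ^+ 2 + b%:~R * x + c%:~R :> R.
  rewrite /d !rmorphD /= !map_polyZ /= map_polyXn map_polyX map_polyC /=.
  by rewrite !ratr_int !hornerE.
have sd : (size d <= 3)%N.
  by apply/leq_sizeP => -[|[|[|j]]] // _; rewrite /d !coefE /= !mulr0 !addr0.
have d0 : d != 0.
  apply/eqP => d0; have : d`_2 = 0 by rewrite d0 coef0.
  rewrite /d !coefE /= mulr1 mulr0 !addr0 => /eqP.
  by rewrite intr_eq0 (negbTE a0).
have hP x : (map_poly ratr P).[x] =
    (map_poly ratr (divp P d)).[x] * (map_poly ratr d).[x] +
    (ratr (modp P d)`_1 * x + ratr (modp P d)`_0) :> R.
  rewrite {1}(divp_eq P d) rmorphD rmorphM /= hornerD hornerM; congr (_ + _).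
  have s2 : (size (modp P d) <= 2)%N.
    by rewrite -ltnS; apply: leq_trans sd; rewrite ltn_modp.
  have s2' : (size (map_poly ratr (modp P d) : {poly R}) <= 2)%N.
    by rewrite size_map_poly.
  rewrite (horner_coef_wide _ s2') !big_ord_recl big_ord0 !coef_map /=.
  by rewrite expr0 expr1 mulr1 addr0 addrC.
rewrite /root !hP !hd Ew Ev !mulr0 !add0r => /eqP.
move=> /(irrational_affine w_irr)[-> ->].
by rewrite !rmorph0 mul0r addr0.
Qed.

(** * The bijection between forms and m-reduced numbers *)

Let r : R := Num.sqrt (2 * p%:Z)%:~R.

Let r2 : r ^+ 2 = (2 * p%:Z)%:~R.
Proof. by rewrite sqr_sqrtr // ler0z; lia. Qed.

Let r_gt0 : 0 < r.
Proof. by rewrite sqrtr_gt0 ltr0z; have := prime_gt0 p_prime; lia. Qed.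

Let r_irr : irrational r.
Proof.
by case=> q _ qr; have /eqP := ratr_sqr_neq_double_prime q; rewrite qr r2.
Qed.

Let int_affine (e f : int) : e%:~R * r + f%:~R = 0 -> e = 0 /\ f = 0.
Proof.
rewrite -!(ratr_int R) => /(irrational_affine r_irr)[].
by move=> /eqP + /eqP; rewrite !intr_eq0 => /eqP -> /eqP ->.
Qed.

Let root_of (t : int * int * int) : R := (t.1.2%:~R + r) / t.1.1%:~R.

(** Comparing coefficients of 1 and [r] over the rationals recovers [a] and [b]; the invariant then
    gives [c]. *)
Lemma root_of_inj : {in forms p &, injective root_of}.
Proof.
move=> [[a b] c] [[a' b'] c']; rewrite !in_forms /root_of /=.
move=> /and4P[a0 _ _ /eqP E] /and4P[a'0 _ _ /eqP E'] eq_root.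
have aR : a%:~R != 0 :> R by rewrite intr_eq0; lia.
have a'R : a'%:~R != 0 :> R by rewrite intr_eq0; lia.
have [] : a' - a = 0 /\ a' * b - a * b' = 0.
  apply: int_affine.
  have : (b%:~R + r) * a'%:~R = (b'%:~R + r) * a%:~R.
    by apply/eqP; rewrite -eqr_div //; apply/eqP.
  by move/eqP; rewrite -subr_eq0 => /eqP <-; rewrite !rmorphB !rmorphM /=; ring.
move=> /subr0_eq ea; rewrite ea -mulrBr => /eqP.
rewrite mulf_eq0 subr_eq0 gt_eqF //= => /eqP eb.
congr (_, _, _) => //; apply: (mulfI (lt0r_neq0 a0)).
by move: E'; rewrite -E -eb ea; lia.
Qed.

(** Let a prime [q] divide all three coefficients. If [q = 2], then [b ^+ 2] would be 2 modulo 4.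
    Otherwise [q] divides [b], so its square divides [2 * p]; this forces [q = p] and then [p]
    divides 2. *)
Lemma forms_primitive a b c :
  (a, b, c) \in forms p -> gcdz (gcdz a (- (2 * b))) c = 1.
Proof.
rewrite in_forms => /and4P[a0 c0 _ /eqP E].
set g := gcdz _ c; apply/eqP/negPn/negP => g1.
have g0 : g != 0 by rewrite gcdz_eq0 negb_and (gt_eqF c0) orbT.
have g_gt1 : (1 < absz g)%N.
  by have : g = absz g by []; move: (g) g0 g1; lia.
have q_prime := pdiv_prime g_gt1; set q := pdiv _ in q_prime.
have : (q%:Z %| g)%Z by rewrite dvdzE pdiv_dvd.
rewrite !dvdz_gcd => /andP[/andP[/dvdzP[i ea] q_2b] /dvdzP[k ec]].
have q_neq2 : q <> 2%N.
  move=> q2; move: E; rewrite ea ec q2.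
  by have [j [->|->]] := int_halves b; lia.
have prime2 : (q %| 2)%N -> q = 2%N by rewrite dvdn_prime2 // => /eqP.
move: q_2b; rewrite dvdzE abszN abszM Euclid_dvdM // => /orP[/prime2 //|q_b].
have /dvdzP[j eb] : (q%:Z %| b)%Z by rewrite dvdzE.
have Eq : q%:Z * (q%:Z * (j ^+ 2 - i * k)) = 2 * p%:Z.
  by rewrite -E ea eb ec; ring.
have : (q%:Z %| 2 * p%:Z)%Z by rewrite -Eq dvdz_mulr.
rewrite dvdzE abszM Euclid_dvdM // => /orP[/prime2 //|].
rewrite dvdn_prime2 // => /eqP q_p.
have p0 := prime_gt0 p_prime.
have p_2 : p%:Z * (j ^+ 2 - i * k) = 2.
  apply: (@mulfI _ p%:Z); first by lia.
  by move: Eq; rewrite (q_p : q = p) => ->; rewrite mulrC.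
have p5 : (5 <= p)%N by move: p_prime p_mod4; case: (p) => [|[|[|[|[|m]]]]].
have : (p%:Z %| 2)%Z.
  by apply/dvdzP; exists (j ^+ 2 - i * k); rewrite mulrC p_2.
by rewrite dvdzE => /(@dvdn_leq _ 2 isT) /(leq_trans p5).
Qed.

(** The bounds on the roots amount to [|a - b| < r < b], which holds because
    [b ^+ 2 - r ^+ 2 = a * c] and [r ^+ 2 - (a - b) ^+ 2 = a * (2 * b - (a + c))] are positive. *)
Lemma root_of_m_reduced t : t \in forms p ->
  @m_reduced_disc R (8 * p%:Z) (root_of t).
Proof.
case: t => [[a b] c] abc; have := abc.
rewrite in_forms => /and4P[a0 c0 lt_b /eqP E].
have aR : 0 < a%:~R :> R by rewrite ltr0z.
have cR : 0 < c%:~R :> R by rewrite ltr0z.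
have lt_bR : a%:~R + c%:~R < 2 * b%:~R :> R.
  by rewrite -intrD -[2]/(2%:~R) -intrM ltr_int.
have ER : b%:~R ^+ 2 - a%:~R * c%:~R = r ^+ 2.
  by rewrite r2 -E rmorphB rmorphXn rmorphM.
have an0 := lt0r_neq0 aR.
have r0 := r_gt0; pose w := root_of (a, b, c); pose v := (b%:~R - r) / a%:~R.
have wE : a%:~R * w = b%:~R + r by rewrite /w /root_of /= mulrC divfK.
have vE : a%:~R * v = b%:~R - r by rewrite /v mulrC divfK.
have poly_root (z : R) : (a%:~R * z - b%:~R) ^+ 2 = r ^+ 2 ->
    a%:~R * z ^+ 2 + (- (2 * b))%:~R * z + c%:~R = 0.
  move=> Ez; apply: (mulfI an0); rewrite mulr0.
  have -> : a%:~R * (a%:~R * z ^+ 2 + (- (2 * b))%:~R * z + c%:~R)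
      = (a%:~R * z - b%:~R) ^+ 2 - (b%:~R ^+ 2 - a%:~R * c%:~R).
    by rewrite rmorphN rmorphM /=; ring.
  by rewrite Ez ER subrr.
have w_root := poly_root w; have v_root := poly_root v.
have {}w_root : a%:~R * w ^+ 2 + (- (2 * b))%:~R * w + c%:~R = 0.
  by apply: w_root; rewrite wE; ring.
have {}v_root : a%:~R * v ^+ 2 + (- (2 * b))%:~R * v + c%:~R = 0.
  by apply: v_root; rewrite vE; ring.
have vw : v != w.
  apply/eqP => vw; have : a%:~R * w = a%:~R * v by rewrite vw.
  by rewrite wE vE; lra.
have w_irr : irrational w.
  case=> q _ qw; have [] := @irrational_affine r 1 (b%:~R - a%:~R * q) r_irr.
    by rewrite rmorph1 rmorphB rmorphM /= !ratr_int qw wE; ring.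
  by move/eqP; rewrite oner_eq0.
have b0 : 0 < b%:~R :> R by lra.
have lt_rb : r < b%:~R.
  by rewrite -ltr_sqr ?nnegrE ?ltW // -subr_gt0 -ER opprB addrC subrK mulr_gt0.
have /ltr_normlP[lt1 lt2] : `|a%:~R - b%:~R| < r.
  rewrite -ltr_sqr ?nnegrE ?normr_ge0 ?ltW // real_normK ?num_real //.
  rewrite -ER -subr_gt0.
  have -> : b%:~R ^+ 2 - a%:~R * c%:~R - (a%:~R - b%:~R) ^+ 2 =
     a%:~R * (2 * b%:~R - (a%:~R + c%:~R)) :> R by ring.
  by rewrite mulr_gt0 // subr_gt0.
split; last first.
  exists a, (- (2 * b)), c; split => //; first exact: forms_primitive.
  have -> : 8 * p%:Z = 4 * (2 * p%:Z) by ring.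
  by rewrite -E; ring.
split.
- split=> //; exists a, (- (2 * b)), c; split=> //; exact: lt0r_neq0.
- by rewrite -(ltr_pM2l aR) mulr1 wE; lra.
- exists v; split.
  + by apply: quadratic_conjugate w_root v_root => //; exact: lt0r_neq0.
  + by rewrite -(pmulr_rgt0 _ aR) vE subr_gt0.
  + by rewrite -(ltr_pM2l aR) mulr1 vE; lra.
Qed.

(** By Vieta, [c = a * w * v > 0] and [a + b + c = - a * (w - 1) * (1 - v) < 0]. The discriminant
    [8 * p] makes [b] even, and [w > v] identifies [r] with [a * (w - v) / 2]. *)
Lemma m_reduced_root_of w : @m_reduced_disc R (8 * p%:Z) w ->
  exists2 t, t \in forms p & w = root_of t.
Proof.
move=> [[_ w1 [v [cj v0 v1]]] [a [b [c [a0 _ ew eD]]]]].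
have ev := conjugate_root cj ew.
have vw : v != w by case: cj.
have aR : 0 < a%:~R :> R by rewrite ltr0z.
have sumE : b%:~R = - (a%:~R * (w + v)) :> R.
  have /eqP : (w - v) * (a%:~R * (w + v) + b%:~R) = 0.
    by rewrite -[RHS](subrr 0) -{1}ew -ev; ring.
  by rewrite mulf_eq0 subr_eq0 eq_sym (negbTE vw) /= addrC addr_eq0 => /eqP.
have prodE : c%:~R = a%:~R * (w * v) :> R.
  by apply/eqP; rewrite -subr_eq0 -ew sumE; apply/eqP; ring.
have c0 : 0 < c by rewrite -(ltr0z R) prodE !mulr_gt0 //; lra.
have abc : a + b + c < 0.
  rewrite -(ltrz0 R) !rmorphD /= sumE prodE.
  have -> : a%:~R + - (a%:~R * (w + v)) + a%:~R * (w * v)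
          = - (a%:~R * ((w - 1) * (1 - v))) :> R by ring.
  by rewrite oppr_lt0 !mulr_gt0 // subr_gt0.
have [k [eb|eb]] := int_halves b; last by move: eD; rewrite eb; lia.
exists (a, - k, c).
  rewrite in_forms a0 c0; apply/andP; split; first by lia.
  by apply/eqP; move: eD; rewrite eb; lia.
have rE : r = a%:~R * (w - v) / 2.
  apply/eqP; rewrite -(@eqrXn2 _ 2) ?ltW //; last first.
    by rewrite divr_gt0 // mulr_gt0 // subr_gt0; lra.
  rewrite r2; apply/eqP; apply: (@mulfI _ 4); first by rewrite pnatr_eq0.
  have -> : 4 * (2 * p%:Z)%:~R = (8 * p%:Z)%:~R :> R.
    by rewrite !rmorphM /=; ring.
  by rewrite eD rmorphB rmorphXn !rmorphM /= sumE prodE; field.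
have kE : (- k)%:~R = a%:~R * (w + v) / 2 :> R.
  apply: (@mulfI _ 2); first by rewrite pnatr_eq0.
  have -> : 2 * (- k)%:~R = - b%:~R :> R by rewrite eb rmorphN rmorphM /=; ring.
  by rewrite sumE; field.
by rewrite /root_of /= kE rE; field; rewrite gt_eqF.
Qed.

Lemma kappa_plus_forms : kappa_plus R (8 * p%:Z) = #|` forms p|.
Proof.
rewrite /kappa_plus; have -> : @m_reduced_disc R (8 * p%:Z) =
    (root_of @` [set` forms p])%classic.
  apply/seteqP; split=> [w /m_reduced_root_of[t tS ->]|w [t tS <-]].
    by exists t.
  exact: root_of_m_reduced.
rewrite fset_set_image ?set_fsetK; last exact: finite_fset.
apply/esym/(card_fset_image root_of_inj) => [t tS|w /imfsetP[t tS ->]].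
  exact: in_imfset.
by exists t.
Qed.

End Kappa.

Theorem theorem3p1 (R : realType) (p : nat) (x y : int)
    (p_prime : prime p) (p_mod4 : p = 1 %[mod 4])
    (p_sum : p%:Z = x ^+ 2 + y ^+ 2) (x_gt0 : 0 < x) (x_lt_y : x < y) :
  ((kappa_plus R (8 * p%:Z))%:Z = 1 - (-1 : int) ^ x %[mod 4])%Z.
Proof.
have /= m4 := card_forms_mod4 p_prime p_mod4 p_sum x_gt0 x_lt_y.
rewrite kappa_plus_forms //.
(* The right-hand side thus becomes 2 for odd [x] and 0 for even [x]. *)
have -> : (-1 : int) ^ x = 1 - 2 * ((x %% 2)%Z == 1)%:R.
  case: x {p_sum x_lt_y m4} x_gt0 => // n _.
  have -> : ((n %% 2)%Z == 1) = odd n by rewrite modz_nat modn2; case: odd.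
  by rewrite -exprnP -signr_odd; case: odd.
case: eqP m4 => _; lia.
Qed.
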